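(* Let $\rho\in(0,1]$, $\sigma\in[1,\infty)$, and let $x_k=\rho+\sigma+k-2$, $y_k=\rho(\sigma+k-1)$, $k\ge1$ (the shifted Charlier specialization). Then the moment generating function $M(z;\rho,\sigma)=\sum_{n\ge0}a_nz^n$ is given, as a power series in $z$, by $$M(z;\rho,\sigma)=\bigl(1-z(\sigma-1)\bigr)^{-1}\,\frac{{}_1F_1\bigl(\sigma;\,\sigma-\tfrac1z;\,-\rho\bigr)}{{}_1F_1\bigl(\sigma-1;\,\sigma-1-\tfrac1z;\,-\rho\bigr)} .$$
   Context: The moments $a_n$ ($a_0=1$) are the coefficients of the Jacobi continued fraction $$\sum_{n\ge0}a_nz^n=\cfrac{1}{1-x_1z-\cfrac{y_1z^2}{1-x_2z-\cfrac{y_2z^2}{1-x_3z-\ddots}}}\ .$$ The confluent hypergeometric function is ${}_1F_1(a;b;u)=\sum_{r\ge0}\frac{(a)_r}{(b)_r}\frac{u^r}{r!}$ with $(a)_r=a(a+1)\cdots(a+r-1)$. Here ${}_1F_1(a;\beta-\frac1z;-\rho)$ is expanded as a formal power series in $z$ termwise: $${}_1F_1\bigl(a;\beta-\tfrac1z;-\rho\bigr)=\sum_{r\ge0}\frac{(a)_r}{\prod_{j=0}^{r-1}(1-(\beta+j)z)}\,\frac{\rho^r}{r!}\,z^r .$$ *)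

(* Defs.v *)
From HB Require Import structures.
From mathcomp Require Import all_boot all_order all_algebra.
From mathcomp Require Import boolp reals.

Set Implicit Arguments.
Unset Strict Implicit.
Unset Printing Implicit Defensive.

Import Order.TTheory GRing.Theory Num.Theory.
Local Open Scope ring_scope.

(* [f n] is the coefficient of z^n.  A record, so that K[[z]] does not inherit
   the pointwise product of functions. *)
Record fps (K : Type) := FPS { fps_coef :> nat -> K }.

HB.instance Definition _ (K : Type) := gen_eqMixin (fps K).
HB.instance Definition _ (K : Type) := gen_choiceMixin (fps K).

Lemma fpsP (K : Type) (f g : fps K) : (forall n, f n = g n) -> f = g.
Proof. by case: f g => [f] [g] /= fg; congr FPS; apply/funext. Qed.

Section FpsRing.
Variable K : fieldType.
Implicit Types f g h : fps K.

Definition fps_zero : fps K := FPS (fun=> 0).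
Definition fps_opp f : fps K := FPS (fun n => - f n).
Definition fps_add f g : fps K := FPS (fun n => f n + g n).
Definition fps_one : fps K := FPS (fun n => (n == 0%N)%:R).
Definition fps_mul f g : fps K :=
  FPS (fun n => \sum_(i < n.+1) f i * g (n - i)%N).
Definition fps_scale (c : K) f : fps K := FPS (fun n => c * f n).

Fact fps_addA : associative fps_add.
Proof. by move=> f g h; apply: fpsP => n /=; rewrite addrA. Qed.
Fact fps_addC : commutative fps_add.
Proof. by move=> f g; apply: fpsP => n /=; rewrite addrC. Qed.
Fact fps_add0 : left_id fps_zero fps_add.
Proof. by move=> f; apply: fpsP => n /=; rewrite add0r. Qed.
Fact fps_addN : left_inverse fps_zero fps_opp fps_add.
Proof. by move=> f; apply: fpsP => n /=; rewrite addNr. Qed.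

HB.instance Definition _ :=
  GRing.isZmodule.Build (fps K) fps_addA fps_addC fps_add0 fps_addN.

Let T (n : nat) f : {poly K} := \poly_(i < n.+1) f i.

Let coefT n f i : (i <= n)%N -> (T n f)`_i = f i.
Proof. by move=> le_in; rewrite coef_poly ltnS le_in. Qed.

Let mulT n f g i : (i <= n)%N -> fps_mul f g i = (T n f * T n g)`_i.
Proof.
move=> le_in; rewrite coefM /=; apply: eq_bigr => -[j /= lt_ji] _.
rewrite !coefT ?(leq_trans (leq_subr _ _) le_in) //.
by rewrite ltnS in lt_ji; apply: leq_trans lt_ji le_in.
Qed.

Fact fps_mulA : associative fps_mul.
Proof.
move=> f g h; apply: fpsP => n.
transitivity ((T n f * (T n g * T n h))`_n).
  rewrite coefM [LHS]/=; apply: eq_bigr => -[j lt_jn] _.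
  by rewrite coefT //; congr (_ * _); apply: mulT; apply: leq_subr.
rewrite mulrA coefM; apply: esym; apply: eq_bigr => -[j lt_jn] _.
by rewrite (@mulT n) // coefT ?leq_subr.
Qed.
Fact fps_mulC : commutative fps_mul.
Proof. by move=> f g; apply: fpsP => n; rewrite !(@mulT n) // mulrC. Qed.
Fact fps_mul1 : left_id fps_one fps_mul.
Proof.
move=> f; apply: fpsP => n /=; rewrite big_ord_recl /= mul1r subn0.
by rewrite big1 ?addr0 // => i _; rewrite mul0r.
Qed.
Fact fps_mulDl : left_distributive fps_mul fps_add.
Proof.
move=> f g h; apply: fpsP => n /=; rewrite -big_split /=.
by apply: eq_bigr => i _; rewrite mulrDl.
Qed.
Fact fps_one_neq0 : fps_one != 0.
Proof.
apply/eqP => /(congr1 (fun f : fps K => f 0%N)) /= /eqP.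
by rewrite oner_eq0.
Qed.

HB.instance Definition _ := GRing.Zmodule_isComNzRing.Build (fps K)
  fps_mulA fps_mulC fps_mul1 fps_mulDl fps_one_neq0.

Fact fps_scaleA a b f : fps_scale a (fps_scale b f) = fps_scale (a * b) f.
Proof. by apply: fpsP => n /=; rewrite mulrA. Qed.
Fact fps_scale1 : left_id 1 fps_scale.
Proof. by move=> f; apply: fpsP => n /=; rewrite mul1r. Qed.
Fact fps_scaleDr : right_distributive fps_scale +%R.
Proof. by move=> a f g; apply: fpsP => n /=; rewrite mulrDr. Qed.
Fact fps_scaleDl f : {morph fps_scale^~ f : a b / a + b}.
Proof. by move=> a b; apply: fpsP => n /=; rewrite mulrDl. Qed.

HB.instance Definition _ := GRing.Zmodule_isLmodule.Build K (fps K)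
  fps_scaleA fps_scale1 fps_scaleDr fps_scaleDl.

Fact fps_scaleAl (a : K) (f g : fps K) : a *: (f * g) = a *: f * g.
Proof.
apply: fpsP => n /=; rewrite mulr_sumr.
by apply: eq_bigr => i _; rewrite mulrA.
Qed.

HB.instance Definition _ := GRing.Lmodule_isLalgebra.Build K (fps K) fps_scaleAl.
HB.instance Definition _ := GRing.Lalgebra_isComAlgebra.Build K (fps K).

Lemma fps_coef0 n : (0 : fps K) n = 0. Proof. by []. Qed.
Lemma fps_coef1 n : (1 : fps K) n = (n == 0%N)%:R. Proof. by []. Qed.
Lemma fps_coefD f g n : (f + g) n = f n + g n. Proof. by []. Qed.
Lemma fps_coefN f n : (- f) n = - f n. Proof. by []. Qed.
Lemma fps_coefB f g n : (f - g) n = f n - g n. Proof. by []. Qed.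
Lemma fps_coefZ c f n : (c *: f) n = c * f n. Proof. by []. Qed.
Lemma fps_coefM f g n : (f * g) n = \sum_(i < n.+1) f i * g (n - i)%N.
Proof. by []. Qed.
Lemma fps_coef_sum I (r : seq I) (P : pred I) (F : I -> fps K) n :
  (\sum_(i <- r | P i) F i) n = \sum_(i <- r | P i) F i n.
Proof.
by elim/big_rec2: _ => [|i y1 y2 _ <-]; rewrite ?fps_coef0 ?fps_coefD.
Qed.
Lemma fps_coefM0 f g : (f * g) 0%N = f 0%N * g 0%N.
Proof. by rewrite fps_coefM big_ord1. Qed.

Lemma fps_ltM m f g k :
  (forall n, (n < m)%N -> f n = 0) -> (forall n, (n < k)%N -> g n = 0) ->
  forall n, (n < m + k)%N -> (f * g) n = 0.
Proof.
move=> f0 g0 n lt_n; rewrite fps_coefM big1 // => i _.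
have [/f0-> | le_mi] := ltnP i m; first by rewrite mul0r.
rewrite g0 ?mulr0 // ltn_subLR; last by rewrite -ltnS ltn_ord.
by apply: leq_trans lt_n _; rewrite leq_add2r.
Qed.

Lemma fps_ltX f m n : f 0%N = 0 -> (n < m)%N -> (f ^+ m) n = 0.
Proof.
move=> f0; elim: m n => // m IHm n lt_n; rewrite exprS.
by apply: (@fps_ltM 1 _ _ m) IHm _ lt_n => -[].
Qed.

(* If c is the constant coefficient of f and u = 1 - f / c, then
   1 / f = c^-1 (1 + u + u^2 + ...), and u^m only affects degrees >= m. *)
Definition fps_unit : pred (fps K) := fun f => f 0%N != 0.
Definition fps_inv f : fps K :=
  if f 0%N != 0 then
    FPS (fun n => ((f 0%N)^-1 *: \sum_(m < n.+1) (1 - (f 0%N)^-1 *: f) ^+ m) n)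
  else f.

Fact fps_mulV : {in fps_unit, left_inverse 1 fps_inv *%R}.
Proof.
move=> f; rewrite unfold_in /fps_unit => f0; rewrite /fps_inv f0; apply: fpsP => n.
set u := 1 - _; have u0 : u 0%N = 0.
  by rewrite fps_coefB fps_coefZ mulVf // subrr.
have uE : f = f 0%N *: (1 - u) by rewrite /u subKr scalerA divff // scale1r.
transitivity (((f 0%N)^-1 *: (\sum_(m < n.+1) u ^+ m) * f) n).
  rewrite !fps_coefM; apply: eq_bigr => -[i /= lt_in] _; congr (_ * _).
  transitivity (((f 0%N)^-1 *: \sum_(m < i.+1) u ^+ m) i); first by [].
  rewrite !fps_coefZ; congr (_ * _); rewrite !fps_coef_sum.
  rewrite -!(big_mkord xpredT (fun m => (u ^+ m) i)).
  rewrite [RHS](big_cat_nat (n := i.+1)) //= [X in _ = _ + X]big_nat_cond.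
  by rewrite [X in _ = _ + X]big1 ?addr0 // => m /andP[/andP[lt_im _] _]; apply: fps_ltX.
rewrite {2}uE -scalerAl -scalerAr scalerA mulVf // scale1r mulrC -opprB mulNr.
by rewrite -subrX1 opprB fps_coefB fps_ltX // subr0.
Qed.

Fact fps_unitP f g : g * f = 1 -> fps_unit f.
Proof.
move=> /(congr1 (fun h : fps K => h 0%N)); rewrite fps_coefM0 fps_coef1 /= => gf.
by apply/eqP => f0; move/eqP: gf; rewrite f0 mulr0 eq_sym oner_eq0.
Qed.

Fact fps_inv_out : {in [predC fps_unit], fps_inv =1 id}.
Proof.
move=> f; rewrite inE unfold_in /fps_unit /fps_inv => f0.
by rewrite (negbTE f0).
Qed.

HB.instance Definition _ := GRing.ComNzRing_hasMulInverse.Build (fps K)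
  fps_mulV fps_unitP fps_inv_out.

Lemma fps_unitE f : (f \is a GRing.unit) = (f 0%N != 0). Proof. by []. Qed.

Definition fpsX : fps K := FPS (fun n => (n == 1%N)%:R).

Lemma fpsX_lt m n : (n < m)%N -> (fpsX ^+ m) n = 0.
Proof. exact: fps_ltX. Qed.

(* Coefficientwise eventual equality is convergence for the z-adic topology. *)
Definition fps_cvg (u : nat -> fps K) (l : fps K) : Prop :=
  forall n, exists N0, forall N, (N0 <= N)%N -> u N n = l n.

End FpsRing.

Notation "''z'" := (fpsX _) (at level 0) : ring_scope.

Section JFraction.
Variable K : fieldType.
Implicit Types x y : nat -> K.

(* The fraction starting with x_k, with N levels, its tail being cut to 0.
   Only the x_i and y_i with i >= k are used. *)
Fixpoint Jconvergent x y (N k : nat) : fps K :=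
  if N is N'.+1 then
    (1 - x k *: 'z - y k *: 'z ^+ 2 * Jconvergent x y N' k.+1)^-1
  else 0.

(* The coefficient of z^n is the same in all convergents with at least n + 1
   levels, see [Jfraction_cvg]. *)
Definition Jfraction x y : fps K := FPS (fun n => Jconvergent x y n.+1 1 n).

Let den x y k (f : fps K) : fps K := 1 - x k *: 'z - y k *: 'z ^+ 2 * f.

Let den_coef0 x y k f : den x y k f 0%N = 1.
Proof.
by rewrite /den !fps_coefB fps_coefM0 !fps_coefZ fpsX_lt // !mulr0 mul0r !subr0.
Qed.

Lemma Jconvergent_unit x y k (f : fps K) :
  1 - x k *: 'z - y k *: 'z ^+ 2 * f \is a GRing.unit.
Proof. by rewrite fps_unitE den_coef0 oner_eq0. Qed.

Lemma Jconvergent_stable x y N N' k n :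
  (n < N)%N -> (n < N')%N -> Jconvergent x y N k n = Jconvergent x y N' k n.
Proof.
suff H m : forall N N' k, (m <= N)%N -> (m <= N')%N -> forall n, (n < m)%N ->
    (Jconvergent x y N k - Jconvergent x y N' k) n = 0.
  by move=> nN nN'; apply/eqP; rewrite -subr_eq0 -fps_coefB (H n.+1).
elim: m {n N N' k} => // m IHm [|N] [|N'] k // mN mN' n lt_nm.
have {IHm} := IHm N N' k.+1 mN mN'.
set a := Jconvergent _ _ N _; set b := Jconvergent _ _ N' _ => IHm.
rewrite -[_ - _]/((den x y k a)^-1 - (den x y k b)^-1).
have [ua ub] : den x y k a \is a GRing.unit /\ den x y k b \is a GRing.unit.
  by split; apply: Jconvergent_unit.
have -> : (den x y k a)^-1 - (den x y k b)^-1
    = 'z ^+ 2 * (a - b) * (y k *: ((den x y k a)^-1 * (den x y k b)^-1)).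
  have -> : 'z ^+ 2 * (a - b) * (y k *: ((den x y k a)^-1 * (den x y k b)^-1))
      = (den x y k b - den x y k a) * ((den x y k a)^-1 * (den x y k b)^-1).
    rewrite -scalerAr scalerAl; congr (_ * _).
    rewrite /den; set p := 1 - _.
    by rewrite opprD opprK addrACA subrr add0r addrC -mulrBr scalerAl.
  by rewrite mulrBl mulrCA divrr // mulr1 mulrA divrr // mul1r.
apply: (@fps_ltM _ m.+2 _ _ 0) => //; last by rewrite addn0 ltnW.
by apply: (@fps_ltM _ 2 _ _ m) => [i|]; [apply: fpsX_lt | apply: IHm].
Qed.

Lemma Jfraction_cvg x y : fps_cvg (Jconvergent x y ^~ 1) (Jfraction x y).
Proof.
by move=> n; exists n.+1 => N le_nN; apply: Jconvergent_stable.
Qed.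

End JFraction.

Section Hypergeometric.
Variable K : fieldType.

Definition rising (a : K) (r : nat) : K := \prod_(i < r) (a + i%:R).

(* The term of index r of 1F1(a; b - 1/z; - rho): since
   (b - 1/z)_r = (-1)^r z^-r \prod_(j < r) (1 - (b + j) z), the sign cancels
   that of (- rho)^r and a factor z^r is left in the numerator. *)
Definition hyp1F1_term (a b rho : K) (r : nat) : fps K :=
  (rising a r * (rho ^+ r / (r`!)%:R)) *:
    ((\prod_(j < r) (1 - (b + j%:R) *: 'z))^-1 * 'z ^+ r).

(* 1F1(a; b - 1/z; - rho); the term of index r has no coefficient of degree < r, so that the
   coefficient of z^n in the infinite sum is a finite sum. *)
Definition hyp1F1 (a b rho : K) : fps K :=
  FPS (fun n => \sum_(r < n.+1) hyp1F1_term a b rho r n).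

Lemma hyp1F1_cvg a b rho :
  fps_cvg (fun N => \sum_(r < N) hyp1F1_term a b rho r) (hyp1F1 a b rho).
Proof.
move=> n; exists n.+1 => N le_nN; rewrite fps_coef_sum /=.
rewrite -!(big_mkord xpredT (fun r => hyp1F1_term a b rho r n)).
rewrite [LHS](big_cat_nat (n := n.+1)) //= [X in _ + X = _]big_nat_cond.
rewrite [X in _ + X = _]big1 ?addr0 // => r /andP[/andP[lt_nr _] _].
rewrite -fps_coefM (@fps_ltM _ 0 _ _ r) ?mulr0 // => i.
exact: fpsX_lt.
Qed.

Lemma hyp1F1_den_unit (b : K) r :
  \prod_(j < r) (1 - (b + j%:R) *: 'z) \is a @GRing.unit (fps K).
Proof.
elim/big_ind: _ => [|f g uf ug|j _]; [exact: unitr1 | by rewrite unitrM uf |].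
by rewrite fps_unitE fps_coefB fps_coefZ mulr0 subr0 oner_eq0.
Qed.

Lemma hyp1F1_unit a b rho : hyp1F1 a b rho \is a GRing.unit.
Proof.
rewrite fps_unitE /hyp1F1 [fps_coef _ _]big_ord1 /hyp1F1_term /rising !big_ord0.
by rewrite fps_coefZ !expr0 invr1 !mulr1 mul1r invr1 oner_eq0.
Qed.

End Hypergeometric.

(* Main.v *)
Require Import Defs.
From mathcomp Require Import all_boot all_order all_algebra reals.
From mathcomp Require Import ring.

Import Order.TTheory GRing.Theory Num.Theory.
Local Open Scope ring_scope.

(** Put [F s = 1F1(s; s - 1/z; - rho)]. Comparing coefficients of [rho ^ r]
    gives the contiguous relation
      [(1 - s z) F s = (1 - (rho + s) z) F (s + 1)
                        - rho (s + 1) z^2 / (1 - (s + 1) z) F (s + 2)],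
    so that [M k = (1 - s z)^-1 F (s + 1) / F s] with [s = sigma + k - 2]
    satisfies [M k = 1 / (1 - x k z - y k z^2 M (k + 1))]. A family satisfying
    this recursion agrees with the N-th convergents up to order [z ^ N]. *)

Section Limits.
Context {K : fieldType}.
Implicit Types (u v : nat -> fps K) (f g : fps K).

Lemma fps_cvg_unique {u f g} : fps_cvg u f -> fps_cvg u g -> f = g.
Proof.
move=> uf ug; apply: fpsP => n; have [N1 u1] := uf n; have [N2 u2] := ug n.
by rewrite -(u1 (maxn N1 N2)) ?leq_maxl // u2 ?leq_maxr.
Qed.

Lemma fps_cvgS {u f} : fps_cvg u f -> fps_cvg (fun N => u N.+1) f.
Proof. by move=> uf n; have [N0 H] := uf n; exists N0 => N /leqW/H. Qed.

Lemma fps_cvgB {u v f g} :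
  fps_cvg u f -> fps_cvg v g -> fps_cvg (fun N => u N - v N) (f - g).
Proof.
move=> uf vg n; have [N1 H1] := uf n; have [N2 H2] := vg n.
exists (maxn N1 N2) => N; rewrite geq_max => /andP[le1 le2].
by rewrite !fps_coefB H1 ?H2.
Qed.

(** The coefficient of [z^n] in a product involves every coefficient of [u N] up to [n], so the
    thresholds for these finitely many degrees are merged by induction on [n]. *)
Lemma fps_cvgMl f {u g} : fps_cvg u g -> fps_cvg (fun N => f * u N) (f * g).
Proof.
move=> ug n; have [N0 H0] : exists N0, forall N, (N0 <= N)%N ->
    forall i, (i <= n)%N -> u N i = g i.
  elim: n => [|n [N1 H1]].
    by have [N0 H0] := ug 0%N; exists N0 => N /H0 uN i; rewrite leqn0 => /eqP->.
  have [N2 H2] := ug n.+1; exists (maxn N1 N2) => N.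
  rewrite geq_max => /andP[le1 le2] i.
  by rewrite leq_eqVlt ltnS => /orP[/eqP->|le_in]; [apply: H2 | apply: H1].
exists N0 => N le_N; rewrite !fps_coefM; apply: eq_bigr => i _.
by rewrite H0 ?leq_subr.
Qed.

End Limits.

Section JFractionRecursion.
Context {K : fieldType} (x y : nat -> K) (M : nat -> fps K).
Hypothesis M_rec : forall k, (1 <= k)%N ->
  M k = (1 - x k *: 'z - y k *: 'z ^+ 2 * M k.+1)^-1.

Lemma Jconvergent_rec N k n : (1 <= k)%N -> (n < N)%N ->
  Jconvergent x y N k n = M k n.
Proof.
move=> k_gt0 lt_nN; apply/eqP; rewrite -subr_eq0 -fps_coefB; apply/eqP.
elim: N k k_gt0 n lt_nN => // N IHN k k_gt0 n lt_nN.
rewrite (M_rec k) //; have {IHN} := IHN k.+1 isT.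
set a := Jconvergent x y N _; set b := M _ => IHN.
rewrite -[Jconvergent _ _ _ _]/((1 - x k *: 'z - y k *: 'z ^+ 2 * a)^-1).
have := Jconvergent_unit x y k a; have := Jconvergent_unit x y k b.
set A := 1 - _ - _ * a; set B := 1 - _ - _ * b => uB uA.
(* Since [B - A = y_k z^2 (a - b)], each level multiplies the error by [z^2]; gaining one order per
   level is enough. Writing [y k *: 1] lets [ring] treat the scalar as a series. *)
have -> : A^-1 - B^-1 = 'z ^+ 2 * (a - b) * (y k *: 1 * (A^-1 * B^-1)).
  have -> : A^-1 - B^-1 = (B - A) * (A^-1 * B^-1).
    by rewrite mulrBl mulrCA divrr // mulr1 mulrA divrr // mul1r.
  rewrite [RHS]mulrA; congr (_ * _); rewrite /A /B -[y k *: 'z ^+ 2]mulr_algl.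
  by ring.
apply: (@fps_ltM _ N.+2 _ _ 0) => //; last by rewrite addn0 ltnW.
by apply: (@fps_ltM _ 2 _ _ N) => [i|]; [apply: fpsX_lt | apply: IHN].
Qed.

Lemma Jfraction_rec : Jfraction x y = M 1.
Proof. by apply: fpsP => n; apply: Jconvergent_rec. Qed.

End JFractionRecursion.

Lemma one_sub_X_unit {K : fieldType} (c : K) : 1 - c *: 'z \is a GRing.unit.
Proof. by rewrite fps_unitE fps_coefB fps_coefZ mulr0 subr0 oner_eq0. Qed.

Section Contiguity.
Context {K : numFieldType}.
Implicit Types a b s rho : K.

Lemma hyp1F1_term0 a b rho : hyp1F1_term a b rho 0 = 1.
Proof.
by rewrite /hyp1F1_term /rising !big_ord0 !expr0 fact0 invr1 !mulr1 invr1 scale1r.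
Qed.

(** Splits off the last factors of the rising factorial and of the denominator. *)
Lemma hyp1F1_termS a b rho r :
  (1 - (b + r%:R) *: 'z) * (r.+1%:R *: hyp1F1_term a b rho r.+1) =
  ((a + r%:R) * rho) *: ('z * hyp1F1_term a b rho r).
Proof.
rewrite /hyp1F1_term /rising !big_ord_recr /= invrM ?hyp1F1_den_unit //;
  last exact: one_sub_X_unit.
rewrite scalerA -scalerAr -!mulrA mulVKr ?one_sub_X_unit // -scalerAr scalerA.
rewrite !exprS factS natrM; congr (_ *: _); last by ring.
by field; rewrite [1 + _]nat1r !pnatr_eq0 -lt0n fact_gt0.
Qed.

(** Splits off the first factors instead: those that remain are the factors for [a + 1] and
    [b + 1]. *)
Lemma hyp1F1_termS_shift a b rho r :
  (1 - b *: 'z) * (r.+1%:R *: hyp1F1_term a b rho r.+1) =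
  (a * rho) *: ('z * hyp1F1_term (a + 1) (b + 1) rho r).
Proof.
have shift c i : c + (lift ord0 i : 'I_r.+1)%:R = c + 1 + (i : nat)%:R :> K.
  by rewrite /= /bump /= natrD addrA.
rewrite /hyp1F1_term /rising !big_ord_recl /= !addr0.
under eq_bigr => i _ do rewrite shift.
under [\prod_(i < r) (1 - _)]eq_bigr => i _ do rewrite shift.
rewrite invrM ?hyp1F1_den_unit //; last exact: one_sub_X_unit.
rewrite [_^-1 / _]mulrC scalerA -scalerAr -!mulrA mulVKr ?one_sub_X_unit //.
rewrite -scalerAr scalerA.
rewrite !exprS factS natrM; congr (_ *: _); last by ring.
by field; rewrite [1 + _]nat1r !pnatr_eq0 -lt0n fact_gt0.
Qed.

Lemma hyp1F1_term_contiguous s rho r :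
  (1 - s *: 'z) * hyp1F1_term s s rho r.+1 =
  (1 - s *: 'z) * hyp1F1_term (s + 1) (s + 1) rho r.+1 -
  rho *: 'z * hyp1F1_term (s + 1) (s + 1) rho r -
  (rho * (s + 1)) *: 'z ^+ 2 * (1 - (s + 1) *: 'z)^-1 *
    hyp1F1_term (s + 1 + 1) (s + 1 + 1) rho r.
Proof.
have := hyp1F1_termS_shift s s rho r.
have := hyp1F1_termS_shift (s + 1) (s + 1) rho r.
have := hyp1F1_termS (s + 1) (s + 1) rho r.
set t := hyp1F1_term s s rho r.+1.
set t1 := hyp1F1_term _ _ _ r.+1; set u1 := hyp1F1_term _ _ _ r.
set u2 := hyp1F1_term _ _ _ r => E2 E1 E0.
(* Scalars become images under a ring morphism, so that [ring] can compute with them. *)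
have [C CE] : exists C : {rmorphism K -> fps K}, forall c f, c *: f = C c * f.
  by exists (in_alg (fps K)) => c f; rewrite mulr_algl.
have r_unit : C r.+1%:R \is a GRing.unit by rewrite rmorph_unit ?unitfE ?pnatr_eq0.
(* [E1] trades the [s + 2] term for [t1], leaving only [t], [t1] and [u1]. *)
have -> : (rho * (s + 1)) *: 'z ^+ 2 * (1 - (s + 1) *: 'z)^-1 * u2
    = 'z * (r.+1%:R *: t1).
  rewrite -[r.+1%:R *: t1](mulKr (one_sub_X_unit (s + 1))) E1.
  by rewrite !CE; ring.
apply: (mulrI r_unit).
move: E0 E2; rewrite !CE => E0 E2.
rewrite mulrCA E0.
(* Collecting the multiples of [t1] gives the left side of [E2]. By [E0] and [E2] all is then a
   multiple of [rho z u1], and the claim reduces to [s = (s + 1 + r) - (r + 1)]. *)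
transitivity ((1 - C (s + 1 + r%:R) * 'z) * (C r.+1%:R * t1) -
              C (r.+1%:R * rho) * ('z * u1)); last by ring.
by rewrite E2; ring.
Qed.

Lemma hyp1F1_contiguous s rho :
  (1 - s *: 'z) * hyp1F1 s s rho =
  (1 - s *: 'z) * hyp1F1 (s + 1) (s + 1) rho -
  rho *: 'z * hyp1F1 (s + 1) (s + 1) rho -
  (rho * (s + 1)) *: 'z ^+ 2 * (1 - (s + 1) *: 'z)^-1 *
    hyp1F1 (s + 1 + 1) (s + 1 + 1) rho.
Proof.
pose S c N := \sum_(r < N) hyp1F1_term c c rho r.
have S_cvg c : fps_cvg (S c) (hyp1F1 c c rho) by exact: hyp1F1_cvg.
(* The sums without an extra factor [z] get [N + 1] terms and the others [N], matching index [r + 1]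
   with [r]. The index-0 terms equal 1 and give [1 - s z] on both sides. *)
apply: (fps_cvg_unique (fps_cvgMl _ (fps_cvgS (S_cvg s)))).
have := fps_cvgB (fps_cvgB
  (fps_cvgMl (1 - s *: 'z) (fps_cvgS (S_cvg (s + 1))))
  (fps_cvgMl (rho *: 'z) (S_cvg (s + 1))))
  (fps_cvgMl ((rho * (s + 1)) *: 'z ^+ 2 * (1 - (s + 1) *: 'z)^-1)
     (S_cvg (s + 1 + 1))).
move=> + n => /(_ n)[N0 H]; exists N0 => N /H <-; congr (fps_coef _ n).
rewrite /S !big_ord_recl !hyp1F1_term0 ![(1 - s *: 'z) * (1 + _)]mulrDr.
rewrite -[RHS]addrA -[RHS]addrA; congr (_ + _).
rewrite !mulr_sumr -!sumrN -!big_split /=; apply: eq_bigr => r _.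
by rewrite [RHS]addrA; apply: hyp1F1_term_contiguous.
Qed.

Lemma hyp1F1_ratio_rec s rho :
  (1 - s *: 'z)^-1 * (hyp1F1 (s + 1) (s + 1) rho / hyp1F1 s s rho) =
  (1 - (rho + s) *: 'z - (rho * (s + 1)) *: 'z ^+ 2 *
    ((1 - (s + 1) *: 'z)^-1 *
     (hyp1F1 (s + 1 + 1) (s + 1 + 1) rho / hyp1F1 (s + 1) (s + 1) rho)))^-1.
Proof.
have := hyp1F1_contiguous s rho.
set F0 := hyp1F1 s s rho; set F1 := hyp1F1 (s + 1) _ _.
set F2 := hyp1F1 _ _ _; set w := (_ *: 'z ^+ 2); set D := (1 - s *: 'z).
set D1 := (1 - (s + 1) *: 'z) => E.
have uF0 : F0 \is a GRing.unit := hyp1F1_unit _ _ _.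
have uF1 : F1 \is a GRing.unit := hyp1F1_unit _ _ _.
have uD : D \is a GRing.unit := one_sub_X_unit s.
(* This is the contiguous relation divided by [F1], where [(1 - s z) - rho z = 1 - (rho + s) z];
   inverting it gives the recursion. *)
have -> : 1 - (rho + s) *: 'z - w * (D1^-1 * (F2 / F1)) = D * F0 / F1.
  apply: (mulIr uF1); rewrite mulrVK // E /D scalerDl.
  rewrite mulrBl -!mulrA (mulVr uF1) mulr1; ring.
by rewrite invrM ?unitrV ?unitrM ?uD // invrK invrM // [F0^-1 * _]mulrC mulrCA.
Qed.

End Contiguity.

Theorem proposition11p4 (R : realType) (rho sigma : R) (x y : nat -> R)
    (rho_gt0 : 0 < rho) (rho_le1 : rho <= 1) (sigma_ge1 : 1 <= sigma)
    (xE : forall k : nat, (1 <= k)%N -> x k = rho + sigma + k%:R - 2)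
    (yE : forall k : nat, (1 <= k)%N -> y k = rho * (sigma + k%:R - 1)) :
  Jfraction x y =
    (1 - (sigma - 1) *: 'z)^-1 *
      (hyp1F1 sigma sigma rho / hyp1F1 (sigma - 1) (sigma - 1) rho).
Proof.
(* With this shift [x_k = rho + s_k] and [y_k = rho (s_k + 1)], the coefficients of the ratio
   recursion, and [s_1 = sigma - 1]. *)
pose s (k : nat) := sigma + k%:R - 2.
have sS k : s k.+1 = s k + 1 by rewrite /s -natr1; ring.
pose M k : fps R :=
  (1 - s k *: 'z)^-1 * (hyp1F1 (s k + 1) (s k + 1) rho / hyp1F1 (s k) (s k) rho).
rewrite (@Jfraction_rec _ x y M) => [|k k_gt0].
  have s1E : s 1 = sigma - 1 by rewrite /s; ring.
  by rewrite /M s1E subrK.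
have -> : x k = rho + s k by rewrite xE // /s; ring.
have -> : y k = rho * (s k + 1) by rewrite yE // /s; ring.
rewrite /M sS; exact: hyp1F1_ratio_rec.
Qed.
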